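(* Let $k\ge2$, let $0<p_*<k$ and let $\Omega$ be a bounded open subset of $\mathbb{R}^k$. Suppose that $B\subset\mathbb{R}^k$ is closed and $A\subset\Omega$ is a compact $p_*$-admissible set such that $m(A)=0$. Let $g\colon(0,+\infty)\to(0,+\infty)$ be a strictly decreasing function such that $g(0^+)=+\infty$ and $g(t)\le C_1t^{-\beta}$ for $t\in(0,1]$, where $\beta>0$ and $C_1>0$ are constants. Suppose also that $t\mapsto g(1/t)$ belongs to a Hardy field $\mathfrak{R}$ which contains all functions $t^\gamma$, $\gamma\in\mathbb{R}$. Then for any $a>1$ there exists a constant $v\in(0,1)$ such that for any subharmonic function $u$ on $\Omega\setminus B$ satisfying $$u(x)\le g(\operatorname{dist}(x,A\cup B)),\qquad x\in\Omega\setminus(A\cup B),$$ one has $$u(x)\le a\,g(v\operatorname{dist}(x,B)),\qquad x\in\Omega\setminus B.$$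
   Context: $m$ is Lebesgue measure in $\mathbb{R}^k$ and $B(x,R)$ is the open ball in $\mathbb{R}^k$. For $G\subset\mathbb{R}^k$ and $\sigma>0$ put $[G]_\sigma=\{y\in\mathbb{R}^k\setminus G:\ 0<\operatorname{dist}(y,G)\le\sigma\}$. For real $p_*\in(0,k)$ and $q_*=k-p_*$, a compact set $G\subset\mathbb{R}^k$ is $p_*$-admissible if there is a constant $C$ such that $m([G]_\sigma\cap B(x,R))\le C\sigma^{q_*}R^{p_*}$ for any $x\in\mathbb{R}^k$ and any $R,\sigma>0$. Hardy fields: consider real-valued functions defined on intervals $[M,+\infty)$, $M\in\mathbb{R}$, two of them being equivalent if they coincide on some interval $[M,+\infty)$. The equivalence classes (germs at $+\infty$) form a ring. A Hardy field is a subset of this ring that is a field and such that each of its classes contains a function differentiable on some $[M,+\infty)$ whose derivative also has its class in the subset. A function belongs to the Hardy field if its class does. Subharmonic functions are allowed to take the value $-\infty$. *)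

(* Defs.v *)
From HB Require Import structures.
From mathcomp Require Import all_boot all_order all_algebra.
From mathcomp Require Import all_classical all_reals all_analysis.

Set Implicit Arguments.
Unset Strict Implicit.
Unset Printing Implicit Defensive.

Import Order.TTheory GRing.Theory Num.Theory.
Import numFieldNormedType.Exports.

Local Open Scope classical_set_scope.
Local Open Scope ring_scope.

(* The library norm on 'rV[R]_k is the sup norm: it gives the usual topology
   and bounded sets, but balls and distances below are Euclidean.            *)
Section euclidean.
Variables (R : realType) (k : nat).
Implicit Types (x y : 'rV[R]_k) (G : set 'rV[R]_k).

Definition eucl_norm x : R := Num.sqrt (\sum_(i < k) x ord0 i ^+ 2).

Definition eucl_ball x (r : R) : set 'rV[R]_k := [set y | eucl_norm (x - y) < r].

Definition eucl_closed_ball x (r : R) : set 'rV[R]_k :=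
  [set y | eucl_norm (x - y) <= r].

(* equal to +oo when G is empty *)
Definition eucl_edist x G : \bar R :=
  ereal_inf [set (eucl_norm (x - y))%:E | y in G].

(* meaningful for G nonempty only: fine +oo = 0 *)
Definition eucl_dist x G : R := fine (eucl_edist x G).

End euclidean.

(* The product sigma-algebra, generated by the coordinates; since R is second
   countable, it is the Borel sigma-algebra of R^n.                          *)
Definition rV_display : measure_display. Proof. exact: default_measure_display. Qed.

Section rV_measurable.
Variables (R : realType) (n : nat).

Definition rV_coord (i : 'I_n) (x : 'rV[R]_n) : measurableTypeR R := x ord0 i.

Let rV_set0 : g_sigma_preimage rV_coord set0.
Proof. exact: sigma_algebra0. Qed.

Let rV_setC A : g_sigma_preimage rV_coord A -> g_sigma_preimage rV_coord (~` A).
Proof. exact: sigma_algebraC. Qed.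

Let rV_bigcup (F : _^nat) : (forall i, g_sigma_preimage rV_coord (F i)) ->
  g_sigma_preimage rV_coord (\bigcup_i (F i)).
Proof. exact: sigma_algebra_bigcup. Qed.

HB.instance Definition _ := @isMeasurable.Build rV_display 'rV[R]_n
  (g_sigma_preimage rV_coord) rV_set0 rV_setC rV_bigcup.

Lemma measurable_rV_coord (i : 'I_n) : measurable_fun setT (rV_coord i).
Proof.
move=> _ Y mY; rewrite setTI; apply: sub_sigma_algebra => /=.
rewrite -bigcup_seq/=; exists i => /=; first by rewrite mem_index_enum.
by exists Y => //; rewrite setTI.
Qed.

Lemma measurable_rVP d (T : measurableType d) (f : T -> 'rV[R]_n) :
  (forall i, measurable_fun setT (rV_coord i \o f)) -> measurable_fun setT f.
Proof.
move=> mf _ Y mY; rewrite setTI.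
suff : measurable `<=` [set A | measurable (f @^-1` A)] by exact.
apply: smallest_sub.
  split => /=.
  - by rewrite preimage_set0.
  - by move=> A mA; rewrite setTD preimage_setC; exact: measurableC.
  - by move=> F mF; rewrite preimage_bigcup; exact: bigcup_measurable.
rewrite -bigcup_seq => A [i _ [B mB <-]] /=.
rewrite setTI -comp_preimage -[X in measurable X]setTI.
exact: mf.
Qed.

End rV_measurable.

Section rV_cons.
Variables (R : realType) (n : nat).

Definition rV_cons (x : measurableTypeR R * 'rV[R]_n) : 'rV[R]_n.+1 :=
  \row_i (if unlift ord0 i is Some j then x.2 ord0 j else x.1).

Definition rV_uncons (x : 'rV[R]_n.+1) : measurableTypeR R * 'rV[R]_n :=
  (x ord0 ord0, \row_j x ord0 (lift ord0 j)).

Lemma rV_consK : cancel rV_cons rV_uncons.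
Proof.
case=> a x; congr pair; first by rewrite mxE unlift_none.
by apply/rowP => j; rewrite !mxE liftK.
Qed.

Lemma measurable_rV_cons : measurable_fun setT rV_cons.
Proof.
apply: measurable_rVP => i; case: (unliftP ord0 i) => [j ->|->].
- rewrite (_ : _ \o _ = rV_coord j \o snd).
    by apply: measurableT_comp => //; exact: measurable_rV_coord.
  by apply/funext => x; rewrite /= /rV_coord mxE liftK.
- rewrite (_ : _ \o _ = fst) //.
  by apply/funext => x; rewrite /= /rV_coord mxE unlift_none.
Qed.

Lemma measurable_rV_uncons : measurable_fun setT rV_uncons.
Proof.
apply: measurable_fun_pair; first exact: measurable_rV_coord.
apply: measurable_rVP => j.
rewrite (_ : _ \o _ = rV_coord (lift ord0 j)); first exact: measurable_rV_coord.
by apply/funext => x; rewrite /= /rV_coord mxE.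
Qed.

Variable m : {sigma_finite_measure set 'rV[R]_n -> \bar R}.

Local Open Scope ereal_scope.

Definition rV_cons_measure : set 'rV[R]_n.+1 -> \bar R :=
  pushforward (@lebesgue_measure R \x m) rV_cons.

Let cons0 : rV_cons_measure set0 = 0.
Proof. by rewrite /rV_cons_measure /pushforward preimage_set0 measure0. Qed.

Let cons_ge0 A : 0 <= rV_cons_measure A.
Proof. by rewrite /rV_cons_measure /pushforward; apply: integral_ge0. Qed.

Let mcons (A : set 'rV[R]_n.+1) : measurable A -> measurable (rV_cons @^-1` A).
Proof. by move=> mA; rewrite -[X in measurable X]setTI; exact: measurable_rV_cons. Qed.

Let cons_sigma_additive : semi_sigma_additive rV_cons_measure.
Proof.
move=> F mF tF mUF; rewrite /rV_cons_measure /pushforward preimage_bigcup.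
apply: measure_semi_sigma_additive.
- by move=> i; exact: mcons.
- by apply/trivIsetP => i j _ _ ij; rewrite -preimage_setI;
    move/trivIsetP : tF => /(_ _ _ _ _ ij) ->//; rewrite preimage_set0.
- by rewrite -preimage_bigcup; exact: mcons.
Qed.

HB.instance Definition _ := isMeasure.Build _ _ _ rV_cons_measure
  cons0 cons_ge0 cons_sigma_additive.

Let cons_sigma_finite : sigma_finite setT rV_cons_measure.
Proof.
have /sigma_finiteP[F [TF ndF Foo]] := sigma_finiteT (@lebesgue_measure R).
have /sigma_finiteP[G [TG ndG Goo]] := sigma_finiteT m.
exists (fun i => rV_uncons @^-1` (F i `*` G i)).
  rewrite -preimage_bigcup -[LHS](preimage_setT rV_uncons); congr (_ @^-1` _).
  rewrite -setXTT TF TG predeqE => -[x y]; split.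
    move=> [/= [i _ Fx] [j _ Gy]]; exists (maxn i j) => //; split.
    - by move: x Fx; exact/subsetPset/ndF/leq_maxl.
    - by move: y Gy; exact/subsetPset/ndG/leq_maxr.
  by move=> [i _ []/= ? ?]; split; exists i.
move=> i; have [mF Fi] := Foo i; have [mG Gi] := Goo i.
split.
  rewrite -[X in measurable X]setTI; apply: measurable_rV_uncons => //.
  exact: measurableX.
rewrite /rV_cons_measure /pushforward -comp_preimage.
rewrite (_ : _ \o _ = id) ?preimage_id; last exact/funext/rV_consK.
by rewrite product_measure1E// lte_mul_pinfty// ge0_fin_numE.
Qed.

HB.instance Definition _ := Measure_isSigmaFinite.Build _ _ _ rV_cons_measure
  cons_sigma_finite.

End rV_cons.

(* R^0 is a point, of measure 1, and R^(n+1) = R * R^n with the product measure *)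
Fixpoint lebesgue_rV (R : realType) (n : nat) :
    {sigma_finite_measure set 'rV[R]_n -> \bar R} :=
  match n with
  | 0%N => @dirac _ 'rV[R]_0 0 R
  | n'.+1 => rV_cons_measure (lebesgue_rV R n')
  end.

Section subharmonic.
Variables (R : realType) (k : nat).
Local Open Scope ereal_scope.

Definition ball_mean (u : 'rV[R]_k -> \bar R) (x : 'rV[R]_k) (r : R) : \bar R :=
  (fine (lebesgue_rV R k (eucl_ball x r)))^-1%:E *
  \int[lebesgue_rV R k]_(y in eucl_ball x r) u y.

(* Only the values of u on U matter, and u may be identically -oo on some
   connected components of U.                                               *)
Record subharmonic (U : set 'rV[R]_k) (u : 'rV[R]_k -> \bar R) : Prop := {
  subharmonic_lty : forall x, U x -> u x < +oo;
  subharmonic_usc : forall x (c : R), U x -> u x < c%:E ->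
    \forall y \near x, U y -> u y < c%:E;
  subharmonic_mean : forall x r, (0 < r)%R -> eucl_closed_ball x r `<=` U ->
    u x <= ball_mean u x r
}.

End subharmonic.

Section admissible.
Variables (R : realType) (k : nat).

Definition shell (G : set 'rV[R]_k) (sigma : R) : set 'rV[R]_k :=
  [set y | ~ G y /\ (0 < eucl_edist y G <= sigma%:E)%E].

Definition admissible (p : R) (G : set 'rV[R]_k) : Prop :=
  compact G /\
  exists C : R, forall (x : 'rV[R]_k) (rho sigma : R), 0 < rho -> 0 < sigma ->
    (lebesgue_rV R k (shell G sigma `&` eucl_ball x rho) <=
     (C * sigma `^ (k%:R - p) * rho `^ p)%:E)%E.

End admissible.

Section hardy.
Variable R : realType.
Implicit Types (f g : R -> R) (H : set (R -> R)).

Definition germ_eq f g : Prop := \forall t \near +oo, f t = g t.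

(* A set of germs at +oo is represented by the set of all the functions R -> R
   whose germ belongs to it; the values of a function away from +oo, where a
   representative need not be defined, are irrelevant by hardy_germ.         *)
Record hardy_field H : Prop := {
  hardy_germ : forall f g, germ_eq f g -> H f -> H g;
  hardy_one : H (cst 1);
  hardy_sub : forall f g, H f -> H g -> H (f \- g);
  hardy_mul : forall f g, H f -> H g -> H (f \* g);
  hardy_inv : forall f, H f -> ~ germ_eq f (cst 0) ->
    exists2 g, H g & germ_eq (f \* g) (cst 1);
  hardy_derive : forall f, H f -> exists h, [/\ germ_eq f h,
    \forall t \near +oo, derivable h t 1 & H (derive1 h)]
}.

End hardy.

(* Main.v *)
Require Import Defs.
From mathcomp Require Import all_boot all_order all_algebra.
From mathcomp Require Import all_classical all_reals all_analysis.
From mathcomp Require Import measurable_realfun ring lra.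
Import Order.TTheory GRing.Theory Num.Theory.
Import numFieldNormedType.Exports.

Local Open Scope classical_set_scope.
Local Open Scope ring_scope.

(* The Hardy field is only used to see that [t ^+ N * g t] is nondecreasing
   near 0, for an integer [N >= beta + 1]. At a point x0 much closer to A than
   to B, let r be a small multiple of d(x0, B) and suppose that
   [u z <= M / (r - |z - x0|) ^+ N] on B(x0, r). In a ball B(y, rho) with
   [rho = (r - |y - x0|) / 2], u is at most [M / rho ^+ N] everywhere and at
   most [g (eta * rho)] outside the (eta * rho)-neighbourhood of A, which by
   admissibility fills only a proportion O(eta ^ (k - p)) of the ball. The mean
   value inequality and the monotonicity of [t ^+ N * g t] then show that M can
   be replaced by [g (eta * r / 2) * r ^+ N + theta * M], where theta is as
   small as we like with eta. The least M is thus at most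
   [g (eta * r / 2) * r ^+ N / (1 - theta)], so that
   [u x0 <= g (eta * r / 2) / (1 - theta)]. *)

(** * Euclidean norm, its comparison with the sup norm, and its balls *)

Section eucl.
Context {R : realType} {k : nat}.
Implicit Types (x y z : 'rV[R]_k).

Lemma eucl_norm_ge0 x : 0 <= eucl_norm x.
Proof. exact: sqrtr_ge0. Qed.

Lemma eucl_norm_sqr x : eucl_norm x ^+ 2 = \sum_(i < k) x ord0 i ^+ 2.
Proof. by rewrite sqr_sqrtr// sumr_ge0// => i _; exact: sqr_ge0. Qed.

Lemma coord_le_eucl_norm x i : `|x ord0 i| <= eucl_norm x.
Proof.
rewrite -sqrtr_sqr ler_wsqrtr// (bigD1 i)//= lerDl.
by rewrite sumr_ge0// => j _; exact: sqr_ge0.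
Qed.

Lemma eucl_norm_le x (e : R) : 0 <= e -> (forall i, `|x ord0 i| <= e) ->
  eucl_norm x <= k%:R * e.
Proof.
move=> e0 xe; rewrite -(ler_pXn2r (n := 2)) ?nnegrE ?eucl_norm_ge0 ?mulr_ge0//.
rewrite eucl_norm_sqr (@le_trans _ _ (\sum_(i < k) e ^+ 2))//.
  by apply: ler_sum => i _; rewrite -(real_normK (num_real _)) lerXn2r ?nnegrE.
rewrite sumr_const card_ord -[leLHS]mulr_natl exprMn ler_wpM2r ?sqr_ge0//.
by rewrite -natrX ler_nat; case: (k) => // n; rewrite expnS leq_pmulr.
Qed.

(** When both norms are nonzero, expand the sum of the squares of [|y| x_i - |x| y_i], which is
    nonnegative, and divide by [2 |x| |y|]. *)
Lemma cauchy_schwarz_rV x y :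
  \sum_(i < k) x ord0 i * y ord0 i <= eucl_norm x * eucl_norm y.
Proof.
have [x0|x0] := eqVneq (eucl_norm x) 0.
  rewrite x0 mul0r big1// => i _.
  by have := coord_le_eucl_norm x i; rewrite x0 normr_le0 => /eqP->; rewrite mul0r.
have [y0|y0] := eqVneq (eucl_norm y) 0.
  rewrite y0 mulr0 big1// => i _.
  by have := coord_le_eucl_norm y i; rewrite y0 normr_le0 => /eqP->; rewrite mulr0.
have {}x0 : 0 < eucl_norm x by rewrite lt_neqAle eq_sym x0 eucl_norm_ge0.
have {}y0 : 0 < eucl_norm y by rewrite lt_neqAle eq_sym y0 eucl_norm_ge0.
have : 0 <= \sum_(i < k) (eucl_norm y * x ord0 i - eucl_norm x * y ord0 i) ^+ 2.
  by rewrite sumr_ge0// => i _; exact: sqr_ge0.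
under eq_bigr do rewrite sqrrB !exprMn.
rewrite big_split /= sumrB -!mulr_sumr -!eucl_norm_sqr.
rewrite (eq_bigr (fun i => eucl_norm y * eucl_norm x *+ 2 *
    (x ord0 i * y ord0 i))); last by move=> i _; rewrite mulrACA mulrnAl.
rewrite -mulr_sumr; set s := \sum_(i < k) _ => h.
have xy0 := mulr_gt0 x0 y0.
by rewrite -(ler_pM2l xy0); nra.
Qed.

Lemma eucl_normD x y : eucl_norm (x + y) <= eucl_norm x + eucl_norm y.
Proof.
rewrite -(ler_pXn2r (n := 2)) ?nnegrE ?addr_ge0 ?eucl_norm_ge0//.
rewrite eucl_norm_sqr sqrrD !eucl_norm_sqr.
under eq_bigr do rewrite mxE sqrrD.
rewrite !big_split/= lerD2r lerD2l. rewrite -mulr2n lerMn2r/=.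
exact: cauchy_schwarz_rV.
Qed.

Lemma eucl_normN x : eucl_norm (- x) = eucl_norm x.
Proof. by congr Num.sqrt; apply: eq_bigr => i _; rewrite mxE sqrrN. Qed.

Lemma eucl_distC x y : eucl_norm (x - y) = eucl_norm (y - x).
Proof. by rewrite -eucl_normN opprB. Qed.

Lemma eucl_distD z x y :
  eucl_norm (x - y) <= eucl_norm (x - z) + eucl_norm (z - y).
Proof. by rewrite -{1}(subrK z x) -addrA eucl_normD. Qed.

Lemma eucl_dist0 x : eucl_norm (x - x) = 0.
Proof. by rewrite subrr /eucl_norm big1 ?sqrtr0// => i _; rewrite mxE expr0n. Qed.

Lemma coord_le_mx_norm x i : `|x ord0 i| <= `|x|.
Proof.
rewrite [leRHS]/Num.norm/= mx_normrE; apply/bigmax_geP; right => /=.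
by exists (ord0, i).
Qed.

Lemma mx_norm_le x (e : R) : 0 <= e -> (forall i, `|x ord0 i| <= e) -> `|x| <= e.
Proof.
move=> e0 xe; rewrite [leLHS]/Num.norm/= mx_normrE; apply/bigmax_leP; split => //=.
by move=> [i j] _ /=; rewrite ord1.
Qed.

Lemma mx_norm_le_eucl_norm x : `|x| <= eucl_norm x.
Proof. by apply: mx_norm_le (eucl_norm_ge0 _) (coord_le_eucl_norm x). Qed.

Lemma eucl_norm_le_mx_norm x : eucl_norm x <= k%:R * `|x|.
Proof. exact: eucl_norm_le (coord_le_mx_norm x). Qed.

Lemma nbhs_eucl_ball x (e : R) : 0 < e -> nbhs x (eucl_ball x e).
Proof.
move=> e0; apply/nbhs_ballP; exists (e / k.+1%:R) => /=; first by rewrite divr_gt0.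
move=> y; rewrite -ball_normE /= ltr_pdivlMr// mulrC => xy.
apply: le_lt_trans xy; apply: (le_trans (eucl_norm_le_mx_norm _)).
by rewrite ler_wpM2r// ler_nat.
Qed.

Lemma open_euclP (U : set 'rV[R]_k) :
  (forall x, U x -> exists2 e, 0 < e & eucl_ball x e `<=` U) -> open U.
Proof.
move=> hU; rewrite openE => x /hU[e e0 eU].
exact: filterS eU (nbhs_eucl_ball x e e0).
Qed.

Lemma open_eucl_ball x r : open (eucl_ball x r).
Proof.
apply: open_euclP => y; rewrite /eucl_ball/= => xy.
exists (r - eucl_norm (x - y)); first by rewrite subr_gt0.
move=> z /= yz; have := eucl_distD y x z; lra.
Qed.

Lemma closed_eucl_closed_ball x r : closed (eucl_closed_ball x r).
Proof.
rewrite -openC; apply: open_euclP => y; rewrite /eucl_closed_ball/= => /negP.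
rewrite -ltNge => xy; exists (eucl_norm (x - y) - r); first by rewrite subr_gt0.
move=> z; rewrite /eucl_ball/= => yz; apply/negP; rewrite -ltNge.
have := eucl_distD z x y; rewrite (eucl_distC z y); lra.
Qed.

Lemma compact_eucl_closed_ball x r : compact (eucl_closed_ball x r).
Proof.
apply: bounded_closed_compact (closed_eucl_closed_ball x r).
exists (`|x| + r); split; first exact: num_real.
move=> M xM y; rewrite /eucl_closed_ball/= => xy.
rewrite (le_trans _ (ltW xM))// -[y](subrK x) addrC.
rewrite (le_trans (ler_normD _ _))// lerD2l.
by rewrite -normrN opprB (le_trans (mx_norm_le_eucl_norm _)).
Qed.

End eucl.

(** * Lebesgue measure of open sets, cubes and balls *)

Section measure.
Context {R : realType}.

(** For [r > 0] this is the sup norm ball. Written by coordinates, it is visibly in the product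
    sigma-algebra and a product of intervals. *)
Definition cube {k} (x : 'rV[R]_k) (r : R) : set 'rV[R]_k :=
  [set y | forall i, ball (x ord0 i) r (y ord0 i)].

Lemma measurable_cube k (x : 'rV[R]_k) r : measurable (cube x r).
Proof.
rewrite (_ : cube x r =
    \bigcap_i (setT `&` @rV_coord R k i @^-1` ball (x ord0 i) r)).
  apply: fin_bigcap_measurable => // i _.
  by apply: measurable_rV_coord => //; exact: measurable_ball.
apply/seteqP; split=> [y xy i _|y xy i]; first by split=> //; exact: xy.
by have [] := xy i I.
Qed.

(* R^k is second countable: an open set is the union of the cubes with rational
   centre and radius [n.+1^-1] which it contains. *)
Lemma open_measurable_rV k (U : set 'rV[R]_k) : open U -> measurable U.
Proof.
move=> oU; pose c (qn : 'rV[rat]_k * nat) : set 'rV[R]_k :=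
  cube (map_mx ratr qn.1) qn.2.+1%:R^-1.
rewrite (_ : U = \bigcup_qn (if `[< c qn `<=` U >] then c qn else set0)).
  apply: countable_bigcupT_measurable => // qn.
  by case: ifP => // _; exact: measurable_cube.
apply/seteqP; split=> [x Ux|x [qn _]]; last by case: asboolP => // cU /cU.
have /nbhs_ballP[e /= e0 xeU] : nbhs x U by exact: open_nbhs_nbhs.
(* A cube of radius [d] containing [x] lies within [2 * d < e] of [x]. *)
pose n := Num.truncn (2 / e); pose d : R := n.+1%:R^-1.
have d0 : 0 < d by rewrite invr_gt0.
have de : d + d < e.
  have : 2 / e < n.+1%:R by exact: truncnS_gt.
  rewrite ltr_pdivrMr// mulrC -ltr_pdivrMr// -/d => h.
  by rewrite -mulr2n -mulr_natl.
have /choice[q xq] (i : 'I_k) : exists q : rat, ball (ratr q : R) d (x ord0 i).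
  have [|q] := @rat_in_itvoo R (x ord0 i - d) (x ord0 i + d); first by lra.
  rewrite in_itv/= => /andP[q1 q2]; exists q.
  by rewrite -ball_normE /= ltr_norml; apply/andP; split; lra.
exists (\row_i q i, n) => //; case: asboolP => [_ i|[]].
  by rewrite !mxE; exact: xq.
move=> y cy; apply: xeU; rewrite -ball_normE /=.
rewrite (@le_lt_trans _ _ (d + d))//; apply: mx_norm_le => [|i].
  by rewrite addr_ge0// ltW.
move: (cy i) (xq i); rewrite -!ball_normE/= !mxE => h1 h2.
have := ler_distD (ratr (q i)) (x ord0 i) (y ord0 i).
rewrite -/d in h1; rewrite (distrC (ratr _) (x ord0 i)) in h2; lra.
Qed.

Lemma measurable_eucl_ball k (x : 'rV[R]_k) r : measurable (eucl_ball x r).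
Proof. by apply: open_measurable_rV; exact: open_eucl_ball. Qed.

Lemma lebesgue_rV_cube k (x : 'rV[R]_k) r : 0 <= r ->
  lebesgue_rV R k (cube x r) = ((2 * r) ^+ k)%:E.
Proof.
move=> r0; elim: k x => [|k IH] x.
  by rewrite /= diracE mem_set ?expr0// => -[].
rewrite /= /rV_cons_measure /pushforward.
rewrite (_ : _ @^-1` _ = ball (x ord0 ord0) r `*` cube (rV_uncons x).2 r).
  rewrite product_measure1E; [|exact: measurable_ball|exact: measurable_cube].
  by rewrite [X in (X * _)%E](lebesgue_measure_ball _ r0) IH exprS -EFinM mulr_natl.
apply/seteqP; split=> [[a y] /= h|[a y] [/= h1 h2] i].
  split=> [|i]; first by have := h ord0; rewrite mxE unlift_none.
  by have := h (lift ord0 i); rewrite !mxE liftK.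
by rewrite mxE; case: unliftP => [j ->|->] //; have := h2 j; rewrite mxE.
Qed.

Lemma lebesgue_rV_eucl_ball_lty k (x : 'rV[R]_k) r :
  (lebesgue_rV R k (eucl_ball x r) < +oo)%E.
Proof.
have [r0|r0] := leP 0 r; last first.
  rewrite (_ : eucl_ball x r = set0) ?measure0//.
  apply/seteqP; split=> // y /=; rewrite /eucl_ball/=.
  by have := eucl_norm_ge0 (x - y); lra.
apply: (@le_lt_trans _ _ (lebesgue_rV R k (cube x r))).
  apply: le_measure; rewrite ?inE; [exact: measurable_eucl_ball|exact: measurable_cube|].
  move=> y xy i; rewrite -ball_normE /=; apply: le_lt_trans xy.
  by have := coord_le_eucl_norm (x - y) i; rewrite !mxE.
by rewrite lebesgue_rV_cube// ltry.
Qed.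

(** The cube of half side [r / k.+1] fits in the ball, since the Euclidean norm is at most [k] times
    the sup norm; [k.+1] makes the inclusion strict. *)
Lemma lebesgue_rV_eucl_ball_ge k (x : 'rV[R]_k) r : 0 < r ->
  (2 / k.+1%:R) ^+ k * r ^+ k <= fine (lebesgue_rV R k (eucl_ball x r)).
Proof.
move=> r0; rewrite -exprMn -lee_fin fineK.
  rewrite mulrAC -mulrA -(lebesgue_rV_cube k x) ?divr_ge0 ?(ltW r0)//.
  apply: le_measure; rewrite ?inE; [exact: measurable_cube|exact: measurable_eucl_ball|].
  move=> y xy; rewrite /eucl_ball/=.
  apply: (@le_lt_trans _ _ (k%:R * (r / k.+1%:R))).
    apply: eucl_norm_le => [|i]; first by rewrite divr_ge0 ?ltW.
    by move: (xy i); rewrite -ball_normE /= !mxE => /ltW.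
  by rewrite mulrCA gtr_pMr// ltr_pdivrMr// mul1r ltr_nat.
by rewrite ge0_fin_numE// lebesgue_rV_eucl_ball_lty.
Qed.
End measure.

(** * Upper bounds for integrals and ball means *)

(* Subharmonic functions are integrated here without having to check that they
   are measurable. *)
Lemma le_integral_nonmeasurable d (T : measurableType d) (R : realType)
    (mu : {measure set T -> \bar R}) (D : set T) (f g : T -> \bar R) :
  (forall x, D x -> (0 <= g x)%E) -> (forall x, D x -> (f x <= g x)%E) ->
  (\int[mu]_(x in D) f x <= \int[mu]_(x in D) g x)%E.
Proof.
move=> g0 fg; rewrite integralE.
apply: (@le_trans _ _ (\int[mu]_(x in D) (f ^\+)%E x)%E).
  by rewrite geeDl// oppe_le0 integral_ge0.
(* Both sides are now suprema over simple functions, and a simple function below the positive part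
   of [f] is also below [g]. *)
rewrite integral_mkcond [leRHS]integral_mkcond !ge0_integralTE.
- apply: ereal_sup_le => _ [h /= hf <-]; exists h => //= x.
  apply: le_trans (hf x) _; rewrite /patch; case: ifPn => // /set_mem Dx.
  by rewrite funeposE ge_max fg// g0.
- by apply: erestrict_ge0.
- by apply: erestrict_ge0.
Qed.

(** Here [S] is an exceptional set filling at most a proportion [c] of the ball: the extra bound
    [b], allowed on [S] only, contributes at most [b * c] to the mean. *)
Lemma ball_mean_le (R : realType) (k : nat) (u : 'rV[R]_k -> \bar R) x (r : R)
    (S : set 'rV[R]_k) (a b c : R) :
  0 < r -> measurable S -> 0 <= a -> 0 <= b ->
  (lebesgue_rV R k (S `&` eucl_ball x r) <=
    c%:E * lebesgue_rV R k (eucl_ball x r))%E ->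
  (forall y, eucl_ball x r y -> (u y <= a%:E + b%:E * (\1_S y)%:E)%E) ->
  (ball_mean u x r <= (a + b * c)%:E)%E.
Proof.
move=> r0 mS a0 b0 mSD uS; rewrite /ball_mean.
set m := lebesgue_rV R k in mSD *; set D := eucl_ball x r in mSD uS *.
have mD : measurable D by exact: measurable_eucl_ball.
have mDfin : m D \is a fin_num by rewrite ge0_fin_numE// lebesgue_rV_eucl_ball_lty.
have mD0 : 0 < fine (m D).
  apply: lt_le_trans (lebesgue_rV_eucl_ball_ge k x r r0).
  by rewrite mulr_gt0 ?exprn_gt0// divr_gt0.
rewrite lee_pdivrMl//.
apply: (@le_trans _ _ (\int[m]_(y in D) (a%:E + b%:E * (\1_S y)%:E))%E).
  by apply: le_integral_nonmeasurable => // y _; rewrite adde_ge0 ?mule_ge0 ?lee_fin.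
have mI : measurable_fun D (EFin \o (\1_S : _ -> R)).
  by apply/measurable_EFinP; exact: measurable_indic.
rewrite ge0_integralD//=; last 2 first.
- by move=> y _; rewrite mule_ge0 ?lee_fin.
- by apply: measurable_funeM.
rewrite integral_cst// ge0_integralZl_EFin//.
rewrite integral_indic// [X in (a%:E * X)%E](_ : _ = (fine (m D))%:E);
  last by rewrite fineK.
rewrite -(fineK mDfin) in mSD.
apply: le_trans (leeD2l _ (lee_wpmul2l _ mSD)) _; first by rewrite lee_fin.
by rewrite -!EFinM -EFinD lee_fin; lra.
Qed.

(** * Distance to a set, and compactness arguments *)

Section distance.
Context {R : realType} {k : nat}.
Implicit Types (x y : 'rV[R]_k) (G : set 'rV[R]_k).

Lemma eucl_edist_ge x G (s : R) :
  (forall w, G w -> s <= eucl_norm (x - w)) -> (s%:E <= eucl_edist x G)%E.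
Proof. by move=> h; apply: le_ereal_inf_tmp => _ [w /h sw <-]; rewrite lee_fin. Qed.

Lemma eucl_edist_le x G w : G w -> (eucl_edist x G <= (eucl_norm (x - w))%:E)%E.
Proof. by move=> Gw; apply: ereal_inf_lbound; exists w. Qed.

Lemma eucl_edist_fin_num x G : G !=set0 -> eucl_edist x G \is a fin_num.
Proof.
move=> [w Gw]; rewrite ge0_fin_numE.
  exact: le_lt_trans (eucl_edist_le _ _ _ Gw) (ltry _).
by apply: eucl_edist_ge => z _; exact: eucl_norm_ge0.
Qed.

Lemma eucl_dist_ge x G (s : R) : G !=set0 ->
  (forall w, G w -> s <= eucl_norm (x - w)) -> s <= eucl_dist x G.
Proof.
by move=> G0 h; rewrite -lee_fin fineK ?eucl_edist_fin_num// eucl_edist_ge.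
Qed.

Lemma eucl_dist_le x G w : G w -> eucl_dist x G <= eucl_norm (x - w).
Proof.
move=> Gw; rewrite -lee_fin fineK ?eucl_edist_le//.
by apply: eucl_edist_fin_num; exists w.
Qed.

Lemma closed_eucl_gap x G : closed G -> ~ G x ->
  exists2 e : R, 0 < e & forall w, G w -> e <= eucl_norm (x - w).
Proof.
move=> clG Gx.
have /nbhs_ballP[e /= e0 xeG] : nbhs x (~` G).
  by apply: open_nbhs_nbhs; split=> //; exact: closed_openC.
exists e => // w Gw; rewrite leNgt; apply/negP => xw; apply: (xeG w) => //.
by rewrite -ball_normE /=; exact: le_lt_trans (mx_norm_le_eucl_norm _) xw.
Qed.

(** The distance is 1-Lipschitz, so a gap [e] above [s] at [x] leaves a gap [e / 2] on the ball of
    radius [e / 2]. If [G] is empty the distance is +oo and any gap will do. *)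
Lemma closed_eucl_edist_le G (s : R) : closed [set y | (eucl_edist y G <= s%:E)%E].
Proof.
rewrite -openC; apply: open_euclP => x /= /negP; rewrite -ltNge => sx.
have [e e0 se] : exists2 e : R, 0 < e & ((s + e)%:E <= eucl_edist x G)%E.
  case: (eucl_edist x G) sx => [t| |//]; last by exists 1; rewrite ?leey.
  rewrite lte_fin => st; exists (t - s); first by rewrite subr_gt0.
  by rewrite lee_fin subrKC.
exists (e / 2); first by rewrite divr_gt0.
move=> y /= xy; apply/negP; rewrite -ltNge.
apply: (@lt_le_trans _ _ (s + e / 2)%:E); first by rewrite lte_fin ltrDl divr_gt0.
apply: eucl_edist_ge => w /(eucl_edist_le x) xw.
have := le_trans se xw; rewrite lee_fin => h.
have := eucl_distD y x w; rewrite /eucl_ball/= in xy; lra.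
Qed.

(** Links closed neighbourhoods to the shells of [admissible]; closedness gives the positive
    distance that [shell] demands off [G]. *)
Lemma eucl_edist_leE G (s : R) : closed G -> 0 < s ->
  [set y | (eucl_edist y G <= s%:E)%E] = G `|` shell G s.
Proof.
move=> clG s0; apply/seteqP; split=> [y /= ys|y [Gy|[_ /andP[]]]] //=.
  have [Gy|Gy] := pselect (G y); [by left|right; split=> //].
  rewrite ys andbT; have [e e0 h] := closed_eucl_gap _ _ clG Gy.
  by apply: lt_le_trans (eucl_edist_ge _ _ _ h); rewrite lte_fin.
by apply: le_trans (eucl_edist_le _ _ _ Gy) _; rewrite eucl_dist0 lee_fin ltW.
Qed.

Lemma measurable_eucl_edist_le G (s : R) :
  measurable [set y | (eucl_edist y G <= s%:E)%E].
Proof.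
rewrite -[X in measurable X]setCK; apply: measurableC.
by apply: open_measurable_rV; rewrite openC; exact: closed_eucl_edist_le.
Qed.

Lemma compact_sub_open_eucl_ball (K U : set 'rV[R]_k) :
  compact K -> open U -> K `<=` U ->
  exists2 e : R, 0 < e & forall w, K w -> eucl_ball w e `<=` U.
Proof.
move=> /compact_near_coveringP cK oU KU.
have hK : \forall e \near (0 : R)^'+, K `<=` [set w | eucl_ball w e `<=` U].
  apply: cK => x /KU Ux.
  have /nbhs_ballP[e /= e0 xeU] : nbhs x U by exact: open_nbhs_nbhs.
  have e20 : 0 < e / 2 by rewrite divr_gt0.
  exists (eucl_ball x (e / 2), [set d | d < e / 2]).
    by split; [exact: nbhs_eucl_ball|exact: nbhs_right_lt].
  move=> [w d] [/= xw de] y wy; apply: xeU; rewrite -ball_normE /=.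
  apply: le_lt_trans (mx_norm_le_eucl_norm _) _.
  have := eucl_distD w x y; move: xw wy; rewrite /eucl_ball/=; lra.
near (0 : R)^'+ => e; exists e; last exact: (near hK e).
by near: e; exact: nbhs_right_gt.
Unshelve. all: by end_near. Qed.

(** Upper semicontinuity and [u < +oo] bound [u] above near each point; compactness makes the bound
    uniform. *)
Lemma subharmonic_bounded_above (K U : set 'rV[R]_k) (u : 'rV[R]_k -> \bar R) :
  compact K -> K `<=` U -> subharmonic U u ->
  exists L : R, forall z, K z -> (u z <= L%:E)%E.
Proof.
move=> /compact_near_coveringP cK KU su.
have hK : \forall L \near +oo, K `<=` [set z | U z -> (u z <= L%:E)%E].
  apply: cK => x /KU Ux.
  have [c uc] : exists c : R, (u x < c%:E)%E.
    have := subharmonic_lty su Ux; case: (u x) => [t _|//|_].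
      by exists (t + 1); rewrite lte_fin ltrDl.
    by exists 0; exact: ltNyr.
  exists ([set y | U y -> (u y < c%:E)%E], [set L | c < L]).
    split; first exact: subharmonic_usc su _ _ Ux uc.
    exact: nbhs_pinfty_gt (num_real _).
  move=> [y L] [/= uyc cL] Uy; apply: le_trans (ltW (uyc Uy)) _.
  by rewrite lee_fin ltW.
have [M [_ hM]] := hK; exists (M + 1) => z Kz.
by apply: (hM (M + 1) _ z Kz (KU _ Kz)); rewrite ltrDl.
Qed.

End distance.

(** * Density of neighbourhoods of an admissible set *)

(** With [sigma = eta * rho], admissibility bounds the shell by [C * eta ^ (k - p) * rho ^ k], and
    [rho ^ k] is at most a constant times the volume of the ball. Adding the null set [A] to the
    shell costs nothing. *)
Lemma admissible_ball_ratio (R : realType) (k : nat) (p : R) (A : set 'rV[R]_k) :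
  admissible p A -> lebesgue_rV R k A = 0%E ->
  exists2 K : R, 0 < K & forall y (rho eta : R), 0 < rho -> 0 < eta ->
    (lebesgue_rV R k
        ([set z | (eucl_edist z A <= (eta * rho)%:E)%E] `&` eucl_ball y rho) <=
      (K * eta `^ (k%:R - p))%:E * lebesgue_rV R k (eucl_ball y rho))%E.
Proof.
move=> [cA [C hC]] A0; set m := lebesgue_rV R k in A0 hC *.
pose ck : R := (2 / k.+1%:R) ^+ k.
have ck0 : 0 < ck by rewrite exprn_gt0// divr_gt0.
(* [C] may have any sign; [|C| + 1] is positive. *)
exists ((`|C| + 1) / ck); first by rewrite divr_gt0// ltr_wpDl.
move=> y rho eta rho0 eta0; have s0 : 0 < eta * rho by rewrite mulr_gt0.
have clA : closed A by apply: compact_closed => //; exact: norm_hausdorff.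
have mA : measurable A.
  rewrite -[X in measurable X]setCK; apply: measurableC.
  by apply: open_measurable_rV; rewrite openC.
have mB := measurable_eucl_ball k y rho.
rewrite eucl_edist_leE//; set S := shell A _.
have mS : measurable S.
  rewrite (_ : S = [set z | (eucl_edist z A <= (eta * rho)%:E)%E] `\` A).
    by apply: measurableD => //; exact: measurable_eucl_edist_le.
  rewrite eucl_edist_leE//; apply/seteqP; split=> [z [Az hz]|z [[//|]]] //.
  by split=> //; right.
have mBfin : m (eucl_ball y rho) \is a fin_num.
  by rewrite ge0_fin_numE// lebesgue_rV_eucl_ball_lty.
rewrite setIUl; apply: (@le_trans _ _ (m (S `&` eucl_ball y rho))).
  apply: le_trans (measureU2 _ _ _) _; [exact: measurableI|exact: measurableI|].
  rewrite [X in (X + _ <= _)%E](_ : _ = 0%E) ?add0e//.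
  by apply/eqP; rewrite -measure_le0 -A0 le_measure ?inE//; exact: measurableI.
apply: le_trans (hC y rho _ rho0 s0) _.
rewrite -(fineK mBfin) -EFinM lee_fin.
rewrite powRM ?(ltW eta0) ?(ltW rho0)// -!mulrA -powRD; last first.
  by rewrite (gt_eqF rho0) implybT.
rewrite subrK powR_mulrn ?(ltW rho0)//.
have hb := lebesgue_rV_eucl_ball_ge k y rho rho0.
rewrite -/ck -/m in hb.
have e0 : 0 <= eta `^ (k%:R - p) by exact: powR_ge0.
apply: (@le_trans _ _ ((`|C| + 1) * (eta `^ (k%:R - p) * rho ^+ k))).
  rewrite ler_wpM2r ?mulr_ge0 ?exprn_ge0 ?(ltW rho0)//.
  by rewrite (le_trans (ler_norm C))// lerDl.
rewrite ler_pM2l ?ltr_wpDl// mulrCA ler_wpM2l// ler_pdivlMl//.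
Qed.

(** * Monotonicity in Hardy fields *)

(** The derivative is eventually zero or, being invertible, eventually without zeros. In the first
    case [f] is eventually constant; in the second, Rolle's theorem makes it eventually injective,
    so it cannot rise and then decay to 0. *)
Lemma hardy_field_eventually_nonincreasing (R : realType) (H : set (R -> R))
    (f : R -> R) :
  hardy_field H -> H f -> (\forall t \near +oo, 0 < f t) ->
  (forall e, 0 < e -> \forall t \near +oo, f t < e) ->
  exists T : R, forall s t, T < s -> s <= t -> f t <= f s.
Proof.
move=> hH Hf f_gt0 f_small.
have [h [fh dh Hh']] := hardy_derive hH Hf.
have [T [_ hT]] : \forall t \near +oo, [/\ f t = h t, derivable h t 1 & 0 < f t].
  by near=> t; split; near: t.
have [[T' [_ hT']]|[T' [_ hT']]] : (\forall t \near +oo, derive1 h t = 0) \/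
    (\forall t \near +oo, derive1 h t != 0).
  have [h'0|h'0] := pselect (germ_eq (derive1 h) (cst 0)); first by left.
  have [h2 _ h'h2] := hardy_inv hH Hh' h'0; right.
  near=> t; apply/eqP => h't0.
  have : (derive1 h \* h2) t = cst 1 t by near: t.
  by rewrite /= h't0 mul0r => /esym/eqP; rewrite oner_eq0.
- exists (Num.max T T') => s t; rewrite gt_max => /andP[Ts T's].
  rewrite le_eqVlt => /predU1P[->//|st].
  have dst x : x \in `[s, t] -> derivable h x 1.
    by rewrite in_itv/= => /andP[sx _]; have [] := hT x (lt_le_trans Ts sx).
  have [->_ _] := hT s Ts; have [->_ _] := hT t (lt_trans Ts st).
  have [||c] := @MVT R h (derive1 h) s t st.
  - move=> x /subset_itv_oo_cc xst; rewrite derive1E; apply: DeriveDef => //.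
    exact: dst.
  - exact: derivable_within_continuous dst.
  - rewrite in_itv/= => /andP[sc _]; rewrite hT' ?mul0r; last exact: lt_trans sc.
    by move/eqP; rewrite subr_eq0 => /eqP->.
- exists (Num.max T T') => s t; rewrite gt_max => /andP[Ts T's] st.
  rewrite leNgt; apply/negP => fst.
  have fs0 : 0 < f s by have [] := hT s Ts.
  (* As [f] rises from [s] to [t] and drops below [f s] at [w], it takes the value [f s] again in
     [[t, w]]. *)
  have [w /andP[tw fws]] : exists w, (t < w) && (f w < f s).
    have [M [_ hM]] := f_small _ fs0; exists (Num.max t M + 1).
    have tM : Num.max t M < Num.max t M + 1 by rewrite ltrDl.
    by rewrite (le_lt_trans _ tM) ?hM ?(le_lt_trans _ tM)// le_max lexx ?orbT.
  have fhs x : s <= x -> f x = h x.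
    by move=> sx; have [] := hT x (lt_le_trans Ts sx).
  have dh' a b : s <= a -> {in `[a, b], forall x, derivable h x 1}.
    move=> sa x; rewrite in_itv/= => /andP[ax _].
    by have [] := hT x (lt_le_trans Ts (le_trans sa ax)).
  have sw := le_trans st (ltW tw).
  have [c /[!in_itv]/= /andP[tc cw] hcs] : exists2 c, c \in `[t, w] & h c = h s.
    apply: IVT; [exact: ltW|exact: derivable_within_continuous (dh' _ _ st)|].
    by rewrite -!fhs// ge_min le_max (ltW fws) (ltW fst) !orbT.
  have sc : s < c.
    rewrite lt_neqAle (le_trans st tc) andbT; apply/eqP => sc.
    have st' : s = t by apply/le_anti; rewrite st sc tc.
    by rewrite st' ltxx in fst.
  have [x /[!in_itv]/= /andP[sx xc] [dhx hx0]] := @Rolle R h s c sc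
    (fun x xsc => dh' _ _ (lexx s) x (subset_itv_oo_cc xsc))
    (derivable_within_continuous (dh' _ _ (lexx s))) (esym hcs).
  by have := hT' x (lt_trans T's sx); rewrite derive1E hx0 eqxx.
Unshelve. all: by end_near. Qed.

(* [t ^- N * g t^-1] lies in the Hardy field and tends to 0 at infinity. *)
Lemma hardy_exprM_nondecreasing (R : realType) (H : set (R -> R)) (g : R -> R)
    (beta C : R) (N : nat) :
  hardy_field H -> (forall gamma : R, H (fun t => t `^ gamma)) ->
  H (fun t => g t^-1) -> (forall t, 0 < t -> 0 < g t) ->
  (forall t, 0 < t <= 1 -> g t <= C * t `^ (- beta)) -> 0 < C ->
  beta + 1 <= N%:R ->
  exists2 t0, 0 < t0 &
    forall s t, 0 < s -> s <= t -> t < t0 -> s ^+ N * g s <= t ^+ N * g t.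
Proof.
move=> hH powH gH g0 gC C0 bN.
(* The substitution of [t^-1] for [t] turns decrease at infinity into increase near 0. *)
pose f (t : R) := t `^ (- N%:R) * g t^-1.
have [|||T hT] := @hardy_field_eventually_nonincreasing R H f hH.
- exact: (hardy_mul hH (powH _) gH).
- near=> t; have t0 : 0 < t by near: t; exact: (nbhs_pinfty_gt (num_real _)).
  by rewrite mulr_gt0// ?powR_gt0// g0 ?invr_gt0.
- move=> e e0; near=> t.
  have t1 : 1 < t by near: t; exact: (nbhs_pinfty_gt (num_real _)).
  have t0 : 0 < t := lt_trans ltr01 t1.
  have Cet : C / e < t by near: t; exact: (nbhs_pinfty_gt (num_real _)).
  have gt : g t^-1 <= C * t `^ beta.
    have := gC t^-1; rewrite invr_gt0 t0 invf_le1// ltW// => /(_ isT).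
    suff -> : t^-1 `^ (- beta) = t `^ beta by [].
    by rewrite -(powR_inv1 (ltW t0)) -powRrM mulrNN mul1r.
  rewrite /f (@le_lt_trans _ _ (t `^ (- N%:R) * (C * t `^ beta)))//.
    by rewrite ler_wpM2l ?powR_ge0.
  rewrite mulrCA -powRD; last by rewrite (gt_eqF t0) implybT.
  (* [beta + 1 <= N] bounds [f t] by [C / t], which is less than [e] once [t > C / e]. *)
  rewrite (@le_lt_trans _ _ (C * t `^ (-1)))//.
    rewrite ler_pM2l// ler_powR ?(ltW t1)//; lra.
  by rewrite powR_inv1 ?ltW// ltr_pdivrMr// mulrC -ltr_pdivrMr.
exists (Num.max 1 T)^-1; first by rewrite invr_gt0 lt_max ltr01.
move=> s t s0 st; have t0 := lt_le_trans s0 st.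
rewrite -[X in X < _]invrK ltf_pV2 ?posrE ?invr_gt0 ?lt_max ?ltr01//.
rewrite gt_max => /andP[_ Tt].
have fE x : 0 < x -> f x^-1 = x ^+ N * g x.
  move=> x0; rewrite /f invrK powRN powR_mulrn ?invr_ge0 ?(ltW x0)//.
  by rewrite exprVn invrK.
by have := hT _ s^-1 Tt; rewrite lef_pV2 ?posrE// !fE//; exact.
Unshelve. all: by end_near. Qed.

(** * The self-improving estimate on a ball *)

(** [S s] stands for the closed [s]-neighbourhood of [A], and [kappa] bounds its proportion in
    balls. The bound [L] only provides a first finite M and is absent from the conclusion. *)
Lemma self_improving_bound (R : realType) (k : nat) (u : 'rV[R]_k -> \bar R)
    (g : R -> R) (x0 : 'rV[R]_k) (r eta kappa theta L : R) (N : nat)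
    (S : R -> set 'rV[R]_k) :
  0 < r -> 0 < eta <= 1 -> 0 < theta < 1 -> 2 ^+ N * kappa <= theta ->
  (forall y rho, 0 < rho -> eucl_closed_ball y rho `<=` eucl_ball x0 r ->
    (u y <= ball_mean u y rho)%E) ->
  (forall y, eucl_ball x0 r y -> (u y <= L%:E)%E) ->
  (forall t, 0 < t -> 0 <= g t) ->
  (forall s t, 0 < s -> s <= t -> t <= eta * r / 2 ->
    s ^+ N * g s <= t ^+ N * g t) ->
  (forall s, measurable (S s)) ->
  (forall y rho, 0 < rho ->
    (lebesgue_rV R k (S (eta * rho)%R `&` eucl_ball y rho) <=
      kappa%:E * lebesgue_rV R k (eucl_ball y rho))%E) ->
  (forall z s, eucl_ball x0 r z -> 0 < s -> s <= r -> ~ S s z ->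
    (u z <= (g s)%:E)%E) ->
  (u x0 <= ((1 - theta)^-1 * g (eta * r / 2))%:E)%E.
Proof.
move=> r0 /andP[eta0 eta1] /andP[th0 th1] kth subm uL g0 gmono mS mSk uS.
pose V := [set M : R | 0 <= M /\ forall z, eucl_ball x0 r z ->
  (u z <= (M / (r - eucl_norm (x0 - z)) ^+ N)%:E)%E].
pose G := g (eta * r / 2) * r ^+ N.
have er0 : 0 < eta * r / 2 by rewrite divr_gt0// mulr_gt0.
have G0 : 0 <= G by rewrite mulr_ge0 ?g0// exprn_ge0// ltW.
have V_ind M : V M -> V (G + theta * M).
  move=> [M0 uM]; split=> [|z x0z]; first by rewrite addr_ge0// mulr_ge0// ltW.
  (* The weight [r - |x0 - y|] is [2 * rho] at the centre [z] and at least [rho] on the ball; this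
     ratio 2 is the source of the factor [2 ^+ N]. *)
  have [rho rho0 zx] : exists2 rho, 0 < rho & eucl_norm (x0 - z) = r - 2 * rho.
    by exists ((r - eucl_norm (x0 - z)) / 2); [rewrite divr_gt0// subr_gt0|field].
  rewrite zx subKr.
  have rhor : 2 * rho <= r by have := eucl_norm_ge0 (x0 - z); lra.
  have zrho y : eucl_norm (z - y) <= rho -> eucl_norm (x0 - y) <= r - rho.
    by move=> zy; have := eucl_distD z x0 y; lra.
  have sub : eucl_closed_ball z rho `<=` eucl_ball x0 r.
    by move=> y /zrho; rewrite /eucl_ball/=; lra.
  apply: le_trans (subm _ _ rho0 sub) _.
  have erho0 : 0 < eta * rho by rewrite mulr_gt0.
  have b0 : 0 <= M / rho ^+ N by rewrite divr_ge0// exprn_ge0// ltW.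
  apply: (@le_trans _ _ (g (eta * rho) + M / rho ^+ N * kappa)%:E).
    apply: (@ball_mean_le _ _ _ _ _ (S (eta * rho))) => //; [exact: g0|exact: mSk|].
    move=> y /ltW zy; have x0y := sub _ zy.
    rewrite -EFinM -EFinD indicE; have [Sy|Sy] := pselect (S (eta * rho) y).
      rewrite mem_set// mulr1; apply: le_trans (uM _ x0y) _; rewrite lee_fin.
      apply: ler_wpDl; first exact: g0.
      rewrite ler_wpM2l// lef_pV2 ?posrE ?exprn_gt0 ?subr_gt0//.
      rewrite lerXn2r ?nnegrE ?(ltW rho0)//.
        by have := zrho _ zy; lra.
      by have := zrho _ zy; lra.
    rewrite memNset// mulr0 addr0; apply: uS => //.
    by have := ler_piMl (ltW rho0) eta1; lra.
  have rN0 : 0 < rho ^+ N by rewrite exprn_gt0.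
  rewrite lee_fin ler_pdivlMr ?exprn_gt0 ?(mulr_gt0 _ rho0)// mulrDl lerD//.
    (* Multiplied by [(2 / eta) ^+ N], this reads [(2 * rho) ^+ N * g (eta * rho) <= G]. *)
    have h : (eta * rho) ^+ N * g (eta * rho) <=
        (eta * r / 2) ^+ N * g (eta * r / 2).
      by apply: gmono => //; rewrite -mulrA ler_wpM2l ?(ltW eta0)//; lra.
    have c0 : 0 < (2 / eta) ^+ N by rewrite exprn_gt0// divr_gt0.
    have e1 : 2 / eta * (eta * rho) = 2 * rho by field; exact: lt0r_neq0.
    have e2 : 2 / eta * (eta * r / 2) = r by field; exact: lt0r_neq0.
    move: h; rewrite -(ler_pM2l c0) !(mulrA _ (_ ^+ N)) -!exprMn e1 e2.
    by rewrite mulrC [leRHS]mulrC.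
  have -> : M / rho ^+ N * kappa * (2 * rho) ^+ N = 2 ^+ N * kappa * M.
    rewrite exprMn; move: (lt0r_neq0 rN0).
    by move: (rho ^+ N) (2 ^+ N : R) => s t s0; field.
  by rewrite ler_wpM2r.
have VL : V (`|L| * r ^+ N).
  split=> [|z x0z]; first by rewrite mulr_ge0// exprn_ge0// ltW.
  apply: le_trans (uL _ x0z) _; rewrite lee_fin (le_trans (ler_norm L))//.
  have d0 : 0 < r - eucl_norm (x0 - z) by rewrite subr_gt0.
  rewrite ler_pdivlMr ?exprn_gt0// ler_wpM2l// lerXn2r ?nnegrE ?(ltW r0) ?(ltW d0)//.
  by rewrite gerBl eucl_norm_ge0.
have V0 : V !=set0 by exists (`|L| * r ^+ N).
have lbV : has_lbound V by exists 0 => M [].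
have infV : inf V <= G / (1 - theta).
  (* By [V_ind], [inf V <= G + theta * M] for each [M] in [V]; taking the infimum over [M] replaces
     an iteration. *)
  have : (inf V - G) / theta <= inf V.
    apply: lb_le_inf => // M VM.
    by rewrite ler_pdivrMr// lerBlDl mulrC; apply: ge_inf => //; exact: V_ind.
  rewrite ler_pdivrMr// ler_pdivlMr ?subr_gt0//; lra.
have x0x0 : eucl_ball x0 r x0 by rewrite /eucl_ball/= eucl_dist0.
have rN0 : 0 < r ^+ N by rewrite exprn_gt0.
have uV M : V M -> (u x0 <= (M / r ^+ N)%:E)%E.
  by move=> [_ /(_ _ x0x0)]; rewrite eucl_dist0 subr0.
case ux : (u x0) => [q| |]; last by rewrite leNye.
  rewrite lee_fin; have : q * r ^+ N <= inf V.
    by apply: lb_le_inf => // M /uV; rewrite ux lee_fin ler_pdivlMr.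
  move=> /le_trans /(_ infV); rewrite /G mulrAC ler_pM2r//.
  by rewrite mulrC.
by have := uV _ VL; rewrite ux.
Qed.

(** * Choice of the constants, and the cases far from and near [A] *)

Theorem theorem2p5 (R : realType) (k : nat) (p : R)
    (Omega A B : set 'rV[R]_k) (g : R -> R) (beta C1 : R) (H : set (R -> R)) :
  (2 <= k)%N ->
  0 < p < k%:R ->
  open Omega -> bounded_set Omega ->
  closed B -> B !=set0 ->
  A `<=` Omega -> admissible p A -> lebesgue_rV R k A = 0%E ->
  (forall t, 0 < t -> 0 < g t) ->
  (forall s t, 0 < s -> s < t -> g t < g s) ->
  g t @[t --> 0^'+] --> +oo ->
  0 < beta -> 0 < C1 ->
  (forall t, 0 < t <= 1 -> g t <= C1 * t `^ (- beta)) ->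
  hardy_field H -> (forall gamma : R, H (fun t => t `^ gamma)) ->
  H (fun t => g (t^-1)) ->
  forall a : R, 1 < a ->
  exists2 v : R, 0 < v < 1 &
    forall u : 'rV[R]_k -> \bar R,
      subharmonic (Omega `\` B) u ->
      (forall x, (Omega `\` (A `|` B)) x ->
        (u x <= (g (eucl_dist x (A `|` B)))%:E)%E) ->
      forall x, (Omega `\` B) x ->
        (u x <= (a * g (v * eucl_dist x B))%:E)%E.
Proof.
move=> _ /andP[_ pk] oO [M [_ bO]] clB [b0 Bb0] AO admA A0 g0 gdec _ _ C10 gC.
move=> hH powH gH a a1.
have [N bN] : exists N : nat, beta + 1 <= N%:R.
  by exists (Num.truncn (beta + 1)).+1; apply: ltW; exact: truncnS_gt.
have [t0 t00 gmono] :=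
  hardy_exprM_nondecreasing _ _ _ _ _ _ hH powH gH g0 gC C10 bN.
have [K K0 hK] := admissible_ball_ratio _ _ _ _ admA A0.
have [del del0 hdel] := compact_sub_open_eucl_ball _ _ admA.1 oO AO.
have [D D0 hD] : exists2 D : R, 0 < D & forall x, Omega x -> eucl_dist x B <= D.
  exists (k%:R * (`|M| + 1 + `|b0|) + 1).
    by rewrite ltr_wpDl// mulr_ge0// !addr_ge0.
  move=> x /(bO (`|M| + 1)) xM; apply: le_trans (eucl_dist_le _ _ _ Bb0) _.
  apply: le_trans (eucl_norm_le_mx_norm _) _; rewrite ler_wpDr// ler_wpM2l//.
  apply: le_trans (ler_normB _ _) _; rewrite lerD2r; apply: xM.
  by rewrite (le_lt_trans (ler_norm M))// ltrDl.
have geg s t : 0 < s -> s <= t -> g t <= g s.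
  by move=> s0; rewrite le_eqVlt => /predU1P[->//|/(gdec _ _ s0)/ltW].
(* Chosen so that the factor [(1 - theta)^-1] is exactly [a]. *)
pose theta := 1 - a^-1.
have a0 : 0 < a by exact: lt_trans a1.
have ai1 : a^-1 < 1 by rewrite invf_lt1.
have ai0 : 0 < a^-1 by rewrite invr_gt0.
have th01 : 0 < theta < 1 by apply/andP; split; rewrite /theta; lra.
have athE : (1 - theta)^-1 = a by rewrite /theta subKr invrK.
have [eta [eta0 eta1 etaD etaK]] : exists eta : R, [/\ 0 < eta, eta <= 1,
    eta * D < t0 & 2 ^+ N * (K * eta `^ (k%:R - p)) <= theta].
  pose q := k%:R - p; have q0 : 0 < q by rewrite subr_gt0.
  have th0 : 0 < theta by case/andP: th01.
  pose tau := theta / (2 ^+ N * K).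
  have tau0 : 0 < tau by rewrite divr_gt0// mulr_gt0// exprn_gt0.
  have tD0 : 0 < t0 / (2 * D) by rewrite divr_gt0// mulr_gt0.
  have tq0 : 0 < tau `^ q^-1 by rewrite powR_gt0.
  (* [t0 / (2 * D)] keeps the arguments of [g] in the range of monotonicity; [tau ^ (1 / q)] solves
     [2 ^ N * K * eta ^ q = theta]. *)
  exists (Num.min 1 (Num.min (t0 / (2 * D)) (tau `^ q^-1))).
  have h0 : 0 < Num.min 1 (Num.min (t0 / (2 * D)) (tau `^ q^-1)).
    by rewrite !lt_min ltr01 tD0.
  split=> //; first by rewrite ge_min lexx.
    apply: (@le_lt_trans _ _ (t0 / (2 * D) * D)).
      by rewrite ler_pM2r// !ge_min lexx orbT.
    by rewrite invfM mulrA divfK ?lt0r_neq0//; lra.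
  rewrite mulrA -ler_pdivlMl ?mulr_gt0 ?exprn_gt0// [leRHS]mulrC -/tau.
  rewrite [leRHS](_ : tau = (tau `^ q^-1) `^ q); last first.
    by rewrite -powRrM mulVf ?lt0r_neq0// powRr1// ltW.
  apply: ge0_ler_powR; rewrite ?nnegrE ?powR_ge0 ?(ltW q0) ?(ltW h0)//.
  by rewrite !ge_min lexx !orbT.
(* The radius will be [r = c * d]: [c <= 1/2] keeps the ball away from [B], and [2 * c * D <= del]
   keeps it in [Omega] when [x0] is near [A]. Then [v] makes [eta * r / 2] equal to [v * d]. *)
pose c := Num.min 2^-1 (del / (2 * D)).
have c0 : 0 < c by rewrite lt_min invr_gt0 ltr0n divr_gt0// mulr_gt0.
have c12 : c <= 2^-1 by rewrite ge_min lexx.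
have cD : 2 * (c * D) <= del.
  have : c <= del / (2 * D) by rewrite ge_min lexx orbT.
  by rewrite ler_pdivlMr ?mulr_gt0// mulrCA.
pose v := eta * c / 2.
have v0 : 0 < v by rewrite divr_gt0// mulr_gt0.
have ec : eta * c <= c by rewrite ler_piMl// ltW.
exists v; first by rewrite v0 /v; lra.
move=> u su ub x0 [Ox0 Bx0].
pose d := eucl_dist x0 B.
have AB0 : (A `|` B) !=set0 by exists b0; right.
have B0 : B !=set0 by exists b0.
have d0 : 0 < d.
  have [e e0 he] := closed_eucl_gap _ _ clB Bx0.
  exact: lt_le_trans (eucl_dist_ge _ _ _ B0 he).
have dD : d <= D by exact: hD.
have dB w : B w -> d <= eucl_norm (x0 - w) by exact: eucl_dist_le.
have vd0 : 0 < v * d by rewrite mulr_gt0.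
have cd0 : 0 < c * d by rewrite mulr_gt0.
have cdD : c * d <= c * D by rewrite ler_pM2l.
have cd2 : c * d <= 2^-1 * d by rewrite ler_pM2r.
have vcd : v * d <= c * d by rewrite ler_pM2r// /v; lra.
(* The distance to [A] is taken in the extended sense because [A] may be empty. *)
have uS z s : Omega z -> ~ B z -> 0 < s ->
    (forall w, B w -> s <= eucl_norm (z - w)) ->
    (s%:E <= eucl_edist z A)%E -> (u z <= (g s)%:E)%E.
  move=> Oz Bz s0 sB sA.
  have sA' w : A w -> s <= eucl_norm (z - w).
    by move=> Aw; rewrite -lee_fin; apply: le_trans (eucl_edist_le _ _ _ Aw).
  have Az : ~ A z by move=> /sA'; rewrite eucl_dist0 leNgt s0.
  apply: le_trans (ub z _) _; first by split=> // -[].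
  rewrite lee_fin geg//; apply: eucl_dist_ge => // w [Aw|Bw].
  - exact: sA'.
  - exact: sB.
(* If no point of [A] is within [v * d] of [x0], the hypothesis on [u] already gives [g (v * d)],
   and [a > 1]. *)
have [near_A|/forallPNP far_A] :=
    pselect (exists2 w, A w & eucl_norm (x0 - w) < v * d); last first.
  apply: (@le_trans _ _ (g (v * d))%:E).
    apply: uS => // [w /dB|].
      by apply: le_trans; lra.
    apply: eucl_edist_ge => w Aw; rewrite leNgt; apply/negP; exact: far_A.
  by rewrite lee_fin ler_peMl ?ltW// g0.
have [w Aw x0w] := near_A.
have ballO : eucl_closed_ball x0 (c * d) `<=` Omega `\` B.
  move=> z; rewrite /eucl_closed_ball/= => x0z; split.
    apply: (hdel w Aw); rewrite /eucl_ball/= eucl_distC.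
    have := eucl_distD x0 z w; rewrite (eucl_distC z x0); lra.
  by move=> /dB; lra.
have [L hL] := subharmonic_bounded_above _ _ u
  (compact_eucl_closed_ball x0 (c * d)) ballO su.
have sub_ball : eucl_ball x0 (c * d) `<=` eucl_closed_ball x0 (c * d).
  by move=> z; exact: ltW.
have := self_improving_bound _ _ u g x0 (c * d) eta
  (K * eta `^ (k%:R - p)) theta L N
  (fun s => [set z | (eucl_edist z A <= s%:E)%E]).
rewrite athE (_ : eta * (c * d) / 2 = v * d); last by rewrite /v; lra.
apply=> //.
- by rewrite eta0.
- move=> y rho rho0 yx0; apply: (subharmonic_mean su) => // z /yx0/sub_ball.
  exact: ballO.
- by move=> y /sub_ball; exact: hL.
- by move=> t /g0/ltW.
- move=> s t s0 st tvd; apply: gmono => //.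
  apply: le_lt_trans tvd _; apply: le_lt_trans etaD.
  have : eta * (c * d) <= eta * D by rewrite ler_pM2l//; lra.
  have : 0 < eta * (c * d) by rewrite mulr_gt0.
  rewrite /v; lra.
- by move=> s; exact: measurable_eucl_edist_le.
- by move=> y rho rho0; exact: hK.
(* On the ball the distance to [B] is at least [d - c * d >= c * d >= s], so only the distance to
   [A] matters. *)
- move=> z s x0z s0 sr /negP; rewrite -ltNge => /ltW sA.
  have [Oz Bz] := ballO _ (sub_ball _ x0z).
  apply: uS => // w' /dB dw'; rewrite /eucl_ball/= in x0z.
  have := eucl_distD z x0 w'; lra.
Qed.
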